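(* Let $\mathcal{G}$ be an undirected connected graph on $\mathcal{V}=\{1,\dots,n\}$ and let $d\ge2$. For each $i\in\mathcal{V}$ let $\alpha_i>0$ and let $\mathbf{A}_i\in\mathbb{R}^{d\times d}$ be a nonzero symmetric positive semidefinite matrix. Let $\mathbf{x}(0)\in\mathbb{R}^{dn}$, and suppose that the manifolds $\mathcal{X}_i=\mathbf{x}_i(0)+\mathrm{range}(\mathbf{A}_i)$ have a non-empty intersection, $\mathcal{X}:=\bigcap_{i=1}^n\mathcal{X}_i\ne\emptyset$. Let $\gamma_{\min}=\min_{i}\lambda_{\max}^{-1}(\mathbf{A}_i)$, $\alpha_{\max}=\max_i\alpha_i$ and $L_V=\|\mathbf{L}^{\mathrm{o}}\|$. If $0<\alpha_{\max}<2\gamma_{\min}/L_V$, then the sequence $\{\mathbf{x}(k)\}$ generated by $$\mathbf{x}_i(k+1)=\mathbf{x}_i(k)-\alpha_i\sum_{j\in\mathcal{N}_i}\mathbf{A}_i(\mathbf{x}_i(k)-\mathbf{x}_j(k)),\qquad i\in\mathcal{V},\ k=0,1,2,\dots,$$ is bounded and converges geometrically to a consensus point: $\lim_{k\to\infty}\mathbf{x}(k)=\mathbf{1}_n\otimes\mathbf{x}^*$ for a point $\mathbf{x}^*\in\mathcal{X}$.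
   Context: $\mathcal{N}_i$ is the set of neighbors of $i$ in $\mathcal{G}$. $\mathbf{L}^{\mathrm{o}}\in\mathbb{R}^{dn\times dn}$ is the identity-matrix weighted Laplacian of $\mathcal{G}$: its $(i,i)$ block is $|\mathcal{N}_i|\mathbf{I}_d$, its $(i,j)$ block is $-\mathbf{I}_d$ if $j\in\mathcal{N}_i$, and $\mathbf{0}$ otherwise. $\|\cdot\|$ is the Euclidean norm on vectors and the induced (spectral) norm on matrices; $\lambda_{\max}$ is the largest eigenvalue. $\mathbf{x}(k)=[\mathbf{x}_1^\top(k),\dots,\mathbf{x}_n^\top(k)]^\top\in\mathbb{R}^{dn}$ with $\mathbf{x}_i(k)\in\mathbb{R}^d$; $\mathbf{1}_n$ is the all-ones vector. $\mathcal{X}_i\subseteq\mathbb{R}^d$ is the unique linear manifold (affine subspace) containing $\mathbf{x}_i(0)$ whose tangent space is the column space of $\mathbf{A}_i$. Converging geometrically to a limit $\mathbf{z}$ means there exist $C\ge0$ and $q\in[0,1)$ with $\|\mathbf{x}(k)-\mathbf{z}\|\le Cq^k$ for all $k$. *)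

(* Defs.v *)
From mathcomp Require Import all_boot all_order all_algebra.
From mathcomp Require Import all_classical all_reals all_analysis.
Set Implicit Arguments.
Unset Strict Implicit.
Unset Printing Implicit Defensive.
Import Order.TTheory GRing.Theory Num.Theory.
Import numFieldNormedType.Exports.
Local Open Scope classical_set_scope.
Local Open Scope ring_scope.

(* The canonical norm of MathComp-Analysis on matrices is the sup norm of the
   entries, so the Euclidean and spectral norms are defined here. *)
Definition enorm (R : realType) (m : nat) (v : 'cV[R]_m) : R :=
  Num.sqrt (\sum_i v i 0 ^+ 2).

Definition opnorm (R : realType) (m p : nat) (M : 'M[R]_(m, p)) : R :=
  sup [set enorm (M *m v) | v in [set v : 'cV[R]_p | enorm v <= 1]].

(* [eigenvalue] is about row eigenvectors; a square matrix has the same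
   eigenvalues on both sides.  The supremum is a maximum as soon as [M] has a
   real eigenvalue, in particular for a symmetric [M] of positive dimension. *)
Definition lambda_max (R : realType) (m : nat) (M : 'M[R]_m) : R :=
  sup [set a | eigenvalue M a].

Definition sym_psd (R : realType) (m : nat) (M : 'M[R]_m) : Prop :=
  M^T = M /\ forall v : 'cV[R]_m, 0 <= (v^T *m M *m v) 0 0.

(* For n > 0 these are the minimum and the maximum of the family [f]. *)
Definition fam_min (R : realType) (n : nat) (f : 'I_n -> R) : R :=
  inf (range f).
Definition fam_max (R : realType) (n : nat) (f : 'I_n -> R) : R :=
  sup (range f).

Definition connected_graph (n : nat) (e : rel 'I_n) : Prop :=
  [/\ symmetric e, irreflexive e & forall i j, connect e i j].

Definition neighbors (n : nat) (e : rel 'I_n) (i : 'I_n) : {set 'I_n} :=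
  [set j | e i j]%SET.

(* R^{dn} is represented by n stacked blocks of size d; its dimension is
   written [\sum_(i < n) d], the form required by the block operators. *)
Notation stack_dim n d := (\sum_(i < n) d)%N.

Definition block_laplacian (R : realType) (n d : nat) (e : rel 'I_n) :
    'M[R]_(stack_dim n d) :=
  \mxblock_(i < n, j < n)
    (if i == j then (#|neighbors e i|%:R)%:M
     else if j \in neighbors e i then - 1%:M
     else 0 : 'M[R]_d).

Definition stack (R : realType) (n d : nat) (x : 'I_n -> 'cV[R]_d) :
    'cV[R]_(stack_dim n d) := \mxcol_(i < n) x i.

(* The Kronecker product of the all-ones vector of R^n with [z]. *)
Definition consensus (R : realType) (n d : nat) (z : 'cV[R]_d) :
    'cV[R]_(stack_dim n d) := stack (fun _ : 'I_n => z).

Definition manifold (R : realType) (d : nat) (p : 'cV[R]_d) (A : 'M[R]_d) :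
    set 'cV[R]_d := [set p + A *m v | v in [set: 'cV[R]_d]].

Definition bounded_seq (R : realType) (m : nat) (u : nat -> 'cV[R]_m) : Prop :=
  exists B : R, forall k, enorm (u k) <= B.

Definition geometric_cvg (R : realType) (m : nat) (u : nat -> 'cV[R]_m)
    (z : 'cV[R]_m) : Prop :=
  exists C q : R, [/\ 0 <= C, 0 <= q, q < 1 &
    forall k : nat, enorm (u k - z) <= C * q ^+ k].

(* Main.v *)
Require Import Defs.
From mathcomp Require Import all_boot all_order all_algebra.
From mathcomp Require Import all_classical all_reals all_analysis.
From mathcomp Require Import ring lra.

(** Fix p in the intersection of the manifolds and put y = x - p, stacked into
    one vector.  With M the block-diagonal matrix of the alpha_i A_i and L the
    Laplacian, the iteration reads y <- y - M L y, and y stays in the range of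
    the positive semidefinite matrix M because each x_i(0) - p lies in the range
    of A_i.

    Take the energy F(y) = y^T L y.  One step changes it by
    - 2 (L y)^T M (L y) + (M L y)^T L (M L y).  Since M <= c with
    c = alpha_max / gamma_min ([form_le_lambda_max]) and L <= L_V
    ([form_le_opnorm]), and M^2 <= c M ([sym_psd_sqr_le]), the second term is at
    most c L_V (L y)^T M (L y), so F drops by (2 - c L_V) (L y)^T M (L y) at
    least.  For y = M w the forms (L y)^T M (L y) and F(y) are those of
    M L M L M and M L M at w.  These matrices have the same kernel, and a
    positive semidefinite form dominates, up to a constant, every symmetric form
    vanishing on its kernel ([sym_psd_compare]); hence F decays geometrically
    ([energy_contraction]).

    The limit is found by linear algebra alone.  The range of L M equals that of
    L M L M, so y(0) = f + M L M b for some f in the range of M with L f = 0.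
    The point f is fixed, and y(k) - f = M L z(k), where z is the orbit of M b;
    its norm is bounded by the square root of the energy of z(k)
    ([iteration_geometric_cvg]).  Connectedness makes f a consensus vector
    ([block_laplacian_ker]), and membership of f in the range of M says that the
    common value p + f_i lies in every manifold. *)

Import Order.TTheory GRing.Theory Num.Theory.
Import numFieldNormedType.Exports.
Local Open Scope classical_set_scope.
Local Open Scope ring_scope.

(** * The Euclidean inner product *)

Definition dot {R : realType} {m : nat} (u v : 'cV[R]_m) : R := (u^T *m v) 0 0.

Section InnerProduct.
Variables (R : realType).
Implicit Types m p : nat.

Lemma dotE m (u v : 'cV[R]_m) : dot u v = \sum_i u i 0 * v i 0.
Proof. by rewrite /dot mxE; apply: eq_bigr => i _; rewrite mxE. Qed.

Lemma dotC m (u v : 'cV[R]_m) : dot u v = dot v u.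
Proof. by rewrite !dotE; apply: eq_bigr => i _; rewrite mulrC. Qed.

Lemma dotDl m (u v w : 'cV[R]_m) : dot (u + v) w = dot u w + dot v w.
Proof. by rewrite /dot linearD mulmxDl mxE. Qed.

Lemma dotDr m (u v w : 'cV[R]_m) : dot w (u + v) = dot w u + dot w v.
Proof. by rewrite /dot mulmxDr mxE. Qed.

Lemma dotZl m a (u v : 'cV[R]_m) : dot (a *: u) v = a * dot u v.
Proof. by rewrite /dot linearZ -scalemxAl mxE. Qed.

Lemma dotZr m a (u v : 'cV[R]_m) : dot u (a *: v) = a * dot u v.
Proof. by rewrite /dot -scalemxAr mxE. Qed.

Lemma dotBl m (u v w : 'cV[R]_m) : dot (u - v) w = dot u w - dot v w.
Proof. by rewrite -scaleN1r dotDl dotZl mulN1r. Qed.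

Lemma dotBr m (u v w : 'cV[R]_m) : dot w (u - v) = dot w u - dot w v.
Proof. by rewrite -scaleN1r dotDr dotZr mulN1r. Qed.

Lemma dot0r m (u : 'cV[R]_m) : dot u 0 = 0.
Proof. by rewrite /dot mulmx0 mxE. Qed.

Lemma dot_sumr m (I : finType) (P : pred I) (u : 'cV[R]_m) (F : I -> 'cV[R]_m) :
  dot u (\sum_(i | P i) F i) = \sum_(i | P i) dot u (F i).
Proof. by rewrite /dot mulmx_sumr summxE. Qed.

Lemma dot_mulmxr m p (M : 'M[R]_(m, p)) u v : dot u (M *m v) = dot (M^T *m u) v.
Proof. by rewrite /dot trmx_mul trmxK mulmxA. Qed.

Lemma dot_self_ge0 m (u : 'cV[R]_m) : 0 <= dot u u.
Proof. by rewrite dotE sumr_ge0 // => i _; rewrite -expr2 sqr_ge0. Qed.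

Lemma dot_self_eq0 m (u : 'cV[R]_m) : dot u u = 0 -> u = 0.
Proof.
rewrite dotE => /eqP; rewrite psumr_eq0 => [/allP h|i _]; last first.
  by rewrite -expr2 sqr_ge0.
apply/matrixP => i j; rewrite ord1 mxE; apply/eqP.
by have := h i (mem_index_enum _); rewrite -expr2 sqrf_eq0.
Qed.

Lemma dot_self_gt0 m (u : 'cV[R]_m) : u != 0 -> 0 < dot u u.
Proof.
move=> u0; rewrite lt_neqAle dot_self_ge0 andbT eq_sym.
by apply: contra u0 => /eqP/dot_self_eq0 ->.
Qed.

Lemma sqr_enorm m (u : 'cV[R]_m) : enorm u ^+ 2 = dot u u.
Proof.
rewrite /enorm sqr_sqrtr; first by rewrite dotE; apply: eq_bigr.
by rewrite sumr_ge0 // => i _; rewrite sqr_ge0.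
Qed.

Lemma enormE m (u : 'cV[R]_m) : enorm u = Num.sqrt (dot u u).
Proof. by rewrite -sqr_enorm sqrtr_sqr ger0_norm // sqrtr_ge0. Qed.

Lemma le_entry_enorm m (u : 'cV[R]_m) i : `|u i 0| <= enorm u.
Proof.
rewrite -sqrtr_sqr ler_sqrt; last by rewrite sumr_ge0 // => j _; rewrite sqr_ge0.
by rewrite (bigD1 i) //= lerDl sumr_ge0 // => j _; rewrite sqr_ge0.
Qed.

(** A matrix has finitely many entries, each contributing at most
    [`|Z i j| * dot v v] to the form. *)
Lemma quadratic_form_bounded m (Z : 'M[R]_m) :
  exists2 C, 0 <= C & forall v, dot v (Z *m v) <= C * dot v v.
Proof.
exists (\sum_i \sum_j `|Z i j|).
  by apply: sumr_ge0 => i _; apply: sumr_ge0.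
move=> v; rewrite dotE mulr_suml; apply: ler_sum => i _.
rewrite mxE mulr_sumr mulr_suml; apply: ler_sum => j _.
apply: (le_trans (ler_norm _)).
rewrite !normrM mulrCA; apply: ler_wpM2l => //.
rewrite -sqr_enorm expr2.
by apply: ler_pM => //; apply: le_entry_enorm.
Qed.

Lemma mulmx_bounded m p (M : 'M[R]_(m, p)) :
  exists2 C, 0 <= C & forall v, dot (M *m v) (M *m v) <= C * dot v v.
Proof.
have [C C0 h] := quadratic_form_bounded _ (M^T *m M).
by exists C => // v; have := h v; rewrite -mulmxA dot_mulmxr trmxK.
Qed.

End InnerProduct.

(** * Positive semidefinite forms *)

Section PositiveSemidefinite.
Variables (R : realType) (m : nat).
Implicit Types P G : 'M[R]_m.

Lemma sym_psdP P : sym_psd P <-> P^T = P /\ forall v, 0 <= dot v (P *m v).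
Proof.
by split=> -[h1 h2]; split=> // v; have := h2 v; rewrite /dot mulmxA.
Qed.

Lemma sym_psd_ge0 P : sym_psd P -> forall v, 0 <= dot v (P *m v).
Proof. by case/sym_psdP. Qed.

Lemma dot_symr P u v : P^T = P -> dot u (P *m v) = dot (P *m u) v.
Proof. by move=> {2}<-; rewrite dot_mulmxr. Qed.

Lemma sym_psd1 : sym_psd (1%:M : 'M[R]_m).
Proof.
apply/sym_psdP; split; first exact: trmx1.
by move=> v; rewrite mul1mx dot_self_ge0.
Qed.

Lemma sym_psd_congr P (X : 'M[R]_m) : sym_psd P -> sym_psd (X^T *m P *m X).
Proof.
case/sym_psdP=> hs hp; apply/sym_psdP; split.
  by rewrite !trmx_mul trmxK hs mulmxA.
by move=> v; rewrite -!mulmxA dot_mulmxr trmxK.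
Qed.

Lemma sym_psd_cauchy_schwarz P u v : sym_psd P ->
  dot u (P *m v) ^+ 2 <= dot u (P *m u) * dot v (P *m v).
Proof.
case/sym_psdP=> hs hp.
set a := dot u (P *m u); set b := dot u _; set c := dot v _.
have form s t : 0 <= s ^+ 2 * a - 2 * s * t * b + t ^+ 2 * c.
  have := hp (s *: u - t *: v).
  rewrite mulmxBr -!scalemxAr dotBl !dotBr !dotZl !dotZr.
  have -> : dot v (P *m u) = b by rewrite dot_symr // dotC.
  rewrite -/a -/b -/c => h; apply: le_trans h _.
  by rewrite le_eqVlt; apply/orP; left; apply/eqP; ring.
have a0 : 0 <= a by apply: hp.
have c0 : 0 <= c by apply: hp.
(* The value at (c, b) settles c > 0, the one at (b, a) settles a > 0, and
   the one at (1, b) settles a = c = 0. *)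
have h1 := form c b; have h2 := form b a; have h3 := form 1 b.
have [c_gt0|c_le0] := ltP 0 c.
  have : 0 <= c * (a * c - b ^+ 2) by apply: le_trans h1 _; lra.
  by rewrite pmulr_rge0 // subr_ge0.
have cE : c = 0 by apply/eqP; rewrite eq_le c_le0.
have [a_gt0|a_le0] := ltP 0 a.
  have : 0 <= a * (a * c - b ^+ 2) by apply: le_trans h2 _; lra.
  by rewrite pmulr_rge0 // subr_ge0.
have aE : a = 0 by apply/eqP; rewrite eq_le a_le0.
by move: h3; rewrite aE cE; lra.
Qed.

(** For P with spectrum in [0, c] this is P^2 <= c P; Cauchy-Schwarz for the
    form P, applied to v and P v, replaces the spectral theorem. *)
Lemma sym_psd_sqr_le P c : sym_psd P -> 0 <= c ->
  (forall v, dot v (P *m v) <= c * dot v v) ->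
  forall v, dot (P *m v) (P *m v) <= c * dot v (P *m v).
Proof.
move=> hP c0 hc v.
have [hs hp] := (sym_psdP P).1 hP.
have [->|Pv0] := eqVneq (P *m v) 0; first by rewrite !dot0r mulr0.
have CS := sym_psd_cauchy_schwarz P v (P *m v) hP.
rewrite [dot v (P *m (P *m v))]dot_symr // in CS.
have le2 := ler_wpM2l (hp v) (hc (P *m v)).
have N0 := dot_self_gt0 _ _ _ Pv0.
rewrite -(ler_pM2r N0) -expr2.
by apply: le_trans CS _; apply: le_trans le2 _; rewrite mulrCA mulrA.
Qed.

Lemma sym_psd_sqr_bounded P : sym_psd P ->
  exists2 c, 0 <= c & forall v, dot (P *m v) (P *m v) <= c * dot v (P *m v).
Proof.
move=> hP; have [c c0 hc] := quadratic_form_bounded _ _ P.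
by exists c => //; apply: sym_psd_sqr_le.
Qed.

Lemma sym_psd_form_eq0 P v : sym_psd P -> dot v (P *m v) = 0 -> P *m v = 0.
Proof.
move=> hP hv; have [c c0 hc] := sym_psd_sqr_bounded P hP.
apply: dot_self_eq0; apply/eqP; rewrite eq_le dot_self_ge0 andbT.
by have := hc v; rewrite hv mulr0.
Qed.

(** A matrix G whose kernel contains that of Q vanishes on the columns of the
    cokernel matrix of Q, hence has its rows in the row space of Q. *)
Lemma factor_of_ker_sub p q (G : 'M[R]_(p, m)) (Q : 'M[R]_(q, m)) :
  (forall v : 'cV[R]_m, Q *m v = 0 -> G *m v = 0) -> exists X, G = X *m Q.
Proof.
move=> h; apply/submxP; rewrite submxE; apply/eqP/matrixP => i j.
have : G *m col j (cokermx Q) = 0.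
  by apply: h; rewrite colE mulmxA mulmx_coker mul0mx.
by rewrite colE mulmxA -colE => /matrixP/(_ i 0); rewrite !mxE.
Qed.

(** Write G = X P and G = G Z G; then the form of G at w is a bounded form
    evaluated at P w, and the square norm of P w is at most a multiple of the
    form of P.  This yields spectral gaps without eigenvalues. *)
Lemma sym_psd_compare P G : sym_psd P -> G^T = G ->
  (forall v : 'cV[R]_m, P *m v = 0 -> G *m v = 0) ->
  exists2 C, 0 < C & forall w, dot w (G *m w) <= C * dot w (P *m w).
Proof.
move=> hP hG /factor_of_ker_sub[X GX].
have [c c0 hc] := sym_psd_sqr_bounded P hP.
have [Z GZ] : exists Z, G *m Z *m G = G by exists (pinvmx G); exact: mulmxKpV.
have [K K0 hK] := quadratic_form_bounded _ _ (X^T *m Z *m X).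
exists (K * c + 1); first by rewrite ltr_wpDl ?mulr_ge0.
move=> w.
have -> : dot w (G *m w) = dot (P *m w) (X^T *m Z *m X *m (P *m w)).
  have GZG : G *m (Z *m (G *m w)) = G *m w.
    by rewrite !mulmxA GZ.
  have Gw : G *m w = X *m (P *m w) by rewrite {1}GX mulmxA.
  by rewrite -GZG dot_symr // Gw -!mulmxA [RHS]dot_mulmxr trmxK.
apply: le_trans (hK _) _.
apply: le_trans (ler_wpM2l K0 (hc w)) _.
by rewrite mulrDl mul1r mulrA lerDl (sym_psd_ge0 _ hP).
Qed.

End PositiveSemidefinite.

(** * Largest eigenvalue and spectral norm *)

Section SpectralBounds.
Variables (R : realType) (m : nat).

(** Let l be the supremum of the Rayleigh quotient.  If l were not an
    eigenvalue, l - P would be positive semidefinite with trivial kernel, hence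
    bounded below by a positive multiple of the identity, and l would not be
    the least upper bound. *)
Lemma form_le_lambda_max (P : 'M[R]_m) : sym_psd P ->
  forall v, dot v (P *m v) <= lambda_max P * dot v v.
Proof.
move=> hP v.
have [hs hp] := (sym_psdP _ _ P).1 hP.
have [->|v0] := eqVneq v 0; first by rewrite mulmx0 !dot0r mulr0.
have [C C0 hC] := quadratic_form_bounded _ _ P.
pose S := [set dot w (P *m w) / dot w w | w in [set w : 'cV[R]_m | w != 0]].
have Sv : S (dot v (P *m v) / dot v v) by exists v.
have Sub : has_ubound S.
  by exists C => _ [w w0 <-]; rewrite ler_pdivrMr ?dot_self_gt0.
pose l := sup S.
have hl w : dot w (P *m w) <= l * dot w w.
  have [->|w0] := eqVneq w 0; first by rewrite mulmx0 !dot0r mulr0.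
  by rewrite -ler_pdivrMr ?dot_self_gt0 //; apply: ub_le_sup => //; exists w.
apply: le_trans (hl v) _; rewrite ler_pM2r ?dot_self_gt0 //.
apply: ub_le_sup.
  exists C => a /eigenvalueP[u ua u0].
  have uT0 : u^T != 0 by apply: contra u0 => /eqP h; rewrite -[u]trmxK h trmx0.
  have := hC u^T.
  have -> : P *m u^T = a *: u^T by rewrite -linearZ -ua /= trmx_mul hs.
  by rewrite dotZr ler_pM2r ?dot_self_gt0.
apply: contraT => /=; rewrite /eigenvalue /eigenspace kermx_eq0 negbK.
rewrite row_free_unit => Qu.
pose Q := l%:M - P.
have formQ w : dot w (Q *m w) = l * dot w w - dot w (P *m w).
  by rewrite mulmxBl mul_scalar_mx dotBr dotZr.
have hQ : sym_psd Q.
  apply/sym_psdP; split; first by rewrite linearB /= tr_scalar_mx hs.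
  by move=> w; rewrite formQ subr_ge0.
have [w Qw0|K K0 hK] := sym_psd_compare _ _ Q 1%:M hQ (trmx1 _ _).
  by rewrite mul1mx -[w](mulKmx Qu) -[_ *m w]opprK -mulNmx opprB Qw0 oppr0 mulmx0.
have : l <= l - K^-1.
  apply: ge_sup => [|_ [w w0 <-]]; first by exists (dot v (P *m v) / dot v v).
  rewrite ler_pdivrMr ?dot_self_gt0 // mulrBl.
  have := hK w; rewrite mul1mx formQ mulrC -ler_pdivrMr //.
  by rewrite [K^-1 * _]mulrC; lra.
by rewrite lerBrDl gerDr leNgt invr_gt0 K0.
Qed.

Lemma opnorm_has_ubound (M : 'M[R]_m) :
  has_ubound [set enorm (M *m v) | v in [set v : 'cV[R]_m | enorm v <= 1]].
Proof.
have [C C0 hC] := mulmx_bounded _ _ _ M.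
exists (Num.sqrt C) => _ [w /= w1 <-]; rewrite enormE ler_sqrt //.
apply: le_trans (hC w) _; rewrite -sqr_enorm ler_piMr //.
by rewrite expr_le1 // sqrtr_ge0.
Qed.

Lemma opnorm_ge0 (M : 'M[R]_m) : 0 <= opnorm M.
Proof.
apply: (ub_le_sup (opnorm_has_ubound M)).
exists 0; last by rewrite mulmx0 enormE dot0r sqrtr0.
by rewrite /= enormE dot0r sqrtr0.
Qed.

Lemma opnorm_bound (M : 'M[R]_m) v :
  dot (M *m v) (M *m v) <= opnorm M ^+ 2 * dot v v.
Proof.
have [->|v0] := eqVneq v 0; first by rewrite mulmx0 !dot0r mulr0.
have ev : 0 < enorm v by rewrite enormE sqrtr_gt0 dot_self_gt0.
have eN1 : enorm ((enorm v)^-1 *: v) <= 1.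
  rewrite enormE dotZl dotZr mulrA -expr2 -sqr_enorm -exprMn mulVf ?gt_eqF //.
  by rewrite expr1n sqrtr1.
have : enorm (M *m ((enorm v)^-1 *: v)) <= opnorm M.
  by apply: (ub_le_sup (opnorm_has_ubound M)); exists ((enorm v)^-1 *: v).
have -> : enorm (M *m ((enorm v)^-1 *: v)) = (enorm v)^-1 * enorm (M *m v).
  rewrite enormE -scalemxAr dotZl dotZr mulrA -expr2 -sqr_enorm -exprMn.
  by rewrite sqrtr_sqr ger0_norm // mulr_ge0 ?invr_ge0 ?sqrtr_ge0.
rewrite mulrC ler_pdivrMr // => h.
rewrite -!sqr_enorm -exprMn; apply: lerXn2r => //; rewrite nnegrE ?sqrtr_ge0 //.
by rewrite mulr_ge0 ?opnorm_ge0 ?sqrtr_ge0.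
Qed.

(** Cauchy-Schwarz for v and M v. *)
Lemma form_le_opnorm (M : 'M[R]_m) v : dot v (M *m v) <= opnorm M * dot v v.
Proof.
have M0 := opnorm_ge0 M; have hM := opnorm_bound M v.
have CS := sym_psd_cauchy_schwarz _ _ _ v (M *m v) (sym_psd1 R m).
rewrite !mul1mx in CS.
apply: le_trans (ler_norm _) _.
rewrite -(@ler_pXn2r _ 2) ?nnegrE ?normr_ge0 ?mulr_ge0 ?dot_self_ge0 //.
rewrite real_normK ?num_real //; apply: le_trans CS _.
apply: le_trans (ler_wpM2l (dot_self_ge0 _ _ v) hM) _.
by rewrite exprMn mulrCA expr2.
Qed.

End SpectralBounds.

(** * The iteration y <- y - M L y *)

Section PreconditionedIteration.
Variables (R : realType) (m : nat) (M L : 'M[R]_m) (c l : R).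
Hypotheses (hM : sym_psd M) (hL : sym_psd L) (c0 : 0 <= c) (l0 : 0 <= l).
Hypothesis Mle : forall v, dot v (M *m v) <= c * dot v v.
Hypothesis Lle : forall v, dot v (L *m v) <= l * dot v v.
Hypothesis small_step : c * l < 2.

Let step (y : 'cV[R]_m) := y - M *m (L *m y).

(** If M L M L M w = 0, the form of M vanishes at L M w, then that of L at
    M w. *)
Lemma ker_MLMLM (w : 'cV[R]_m) :
  M *m (L *m (M *m (L *m (M *m w)))) = 0 -> L *m (M *m w) = 0.
Proof.
have [hMs hLs] := (hM.1, hL.1).
move=> h; apply: sym_psd_form_eq0 => //.
rewrite dotC dot_symr //.
have -> : M *m (L *m (M *m w)) = 0; last by rewrite dotC dot0r.
apply: sym_psd_form_eq0 => //.
by rewrite dotC !dot_symr // h dotC dot0r.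
Qed.

(** The energy y^T L y drops by at least (2 - c l) (L y)^T M (L y), which on the
    range of M is comparable with the energy itself. *)
Lemma energy_contraction : exists q, [/\ 0 <= q, q < 1 &
  forall w, let y := M *m w in
    dot (step y) (L *m step y) <= q * dot y (L *m y)].
Proof.
have [hMs hMp] := (sym_psdP _ _ M).1 hM.
have [hLs hLp] := (sym_psdP _ _ L).1 hL.
have MLMs : (M^T *m L *m M)^T = M^T *m L *m M.
  by rewrite !trmx_mul trmxK hLs mulmxA.
have [w|K K0 hK] := sym_psd_compare _ _ _ _
    (sym_psd_congr _ _ M (L *m M) hM) MLMs.
  rewrite trmx_mul hMs hLs -!mulmxA => h.
  by rewrite ker_MLMLM // mulmx0.
pose delta := 2 - c * l; pose K' := K + delta.
have delta0 : 0 < delta by rewrite subr_gt0.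
have K'0 : 0 < K' by rewrite addr_gt0.
exists (1 - delta / K'); split.
- by rewrite subr_ge0 ler_pdivrMr // mul1r lerDr ltW.
- by rewrite gtrDl oppr_lt0 divr_gt0.
move=> w; set y := M *m w; rewrite /=.
set F := dot y _; set D := dot (L *m y) (M *m (L *m y)).
have FD : F <= K' * D.
  apply: le_trans (_ : K * D <= _); last first.
    by rewrite ler_wpM2r ?hMp // lerDl ltW.
  have -> : F = dot w (M *m (L *m (M *m w))) by rewrite dot_symr.
  have -> : D = dot w (M *m (L *m (M *m (L *m y)))).
    by rewrite (dot_symr _ _ M) // -/y (dot_symr _ _ L).
  by have := hK w; rewrite trmx_mul hMs hLs -!mulmxA.
clearbody y.
have E : dot (step y) (L *m step y) =
    F - 2 * D + dot (M *m (L *m y)) (L *m (M *m (L *m y))).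
  rewrite /step mulmxBr dotBl !dotBr.
  rewrite [dot y (L *m (M *m _))]dot_symr // -/F -/D.
  rewrite [dot (M *m _) (L *m y)]dotC -/D; ring.
have B : dot (M *m (L *m y)) (L *m (M *m (L *m y))) <= c * l * D.
  apply: le_trans (Lle _) _; rewrite [c * l]mulrC -mulrA ler_wpM2l //.
  exact: sym_psd_sqr_le.
apply: le_trans (_ : F - delta * D <= _).
  by rewrite E /delta; lra.
rewrite [leRHS]mulrBl mul1r lerD2l lerN2 -mulrA (ler_wpM2l (ltW delta0)) //.
by rewrite ler_pdivrMl.
Qed.

(** The range of L M equals that of L M L M, so y0 = M w0 splits as f + M L M b
    with f in the range of M and L f = 0.  The point f is fixed, and the
    remainder of the orbit is M L applied to the orbit of M b, whose energy
    decays geometrically: the limit is f, without any appeal to completeness. *)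
Lemma iteration_geometric_cvg (y : nat -> 'cV[R]_m) (w0 : 'cV[R]_m) :
  y 0%N = M *m w0 -> (forall k, y k.+1 = step (y k)) ->
  exists2 a, L *m (M *m a) = 0 & geometric_cvg y (M *m a).
Proof.
move=> y0 yS.
have [hMs hMp] := (sym_psdP _ _ M).1 hM.
have [hLs hLp] := (sym_psdP _ _ L).1 hL.
have [v h|X LMX] := factor_of_ker_sub _ _ _ _ (M *m L) (M *m L *m M *m L).
  rewrite -!mulmxA in h *; apply: sym_psd_form_eq0 => //.
  rewrite dotC dot_symr //.
  have -> : L *m (M *m (L *m v)) = 0; last by rewrite dotC dot0r.
  by apply: sym_psd_form_eq0 => //; rewrite dotC dot_symr // h dotC dot0r.
have {}LMX : L *m M = L *m M *m L *m M *m X^T.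
  by have := congr1 trmx LMX; rewrite !trmx_mul hMs hLs !mulmxA.
pose b := X^T *m w0; pose a := w0 - L *m (M *m b).
have La : L *m (M *m a) = 0.
  have := congr1 (mulmx^~ w0) LMX; rewrite /= -!mulmxA -/b => LMw0.
  by rewrite /a !mulmxBr LMw0 subrr.
exists a => //.
pose z k := iter k step (M *m b).
have zM k : exists w, z k = M *m w.
  elim: k => [|k [w zk]]; first by exists b.
  by exists (w - L *m z k); rewrite /z iterS -/(z k) /step {1}zk mulmxBr.
have yz k : y k - M *m a = M *m (L *m z k).
  elim: k => [|k IH]; first by rewrite y0 /a mulmxBr opprB addrC subrK.
  rewrite yS /z iterS -/(z k) /step.
  have -> : L *m y k = L *m (M *m (L *m z k)) by rewrite -IH mulmxBr La subr0.
  by rewrite addrAC IH !mulmxBr.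
have [q [q0 q1 hq]] := energy_contraction.
have zF k : dot (z k) (L *m z k) <= q ^+ k * dot (z 0%N) (L *m z 0%N).
  elim: k => [|k IH]; first by rewrite expr0 mul1r.
  have [w zk] := zM k.
  have := hq w; rewrite /= -zk -[step _]/(z k.+1) => h; apply: le_trans h _.
  by rewrite exprS -mulrA ler_wpM2l.
have [CM CM0 hCM] := mulmx_bounded _ _ _ M.
have [CL CL0 hCL] := sym_psd_sqr_bounded _ _ L hL.
exists (Num.sqrt (CM * CL * dot (z 0%N) (L *m z 0%N))), (Num.sqrt q); split.
- exact: sqrtr_ge0.
- exact: sqrtr_ge0.
- by rewrite -sqrtr1 ltr_sqrt.
move=> k; rewrite yz enormE.
have -> : Num.sqrt q ^+ k = Num.sqrt (q ^+ k).
  by rewrite -[q in RHS]sqr_sqrtr // -exprM mulnC exprM sqrtr_sqr ger0_norm //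
    exprn_ge0 ?sqrtr_ge0.
rewrite -sqrtrM ?mulr_ge0 // ler_sqrt ?mulr_ge0 ?exprn_ge0 //.
apply: le_trans (hCM _) _; rewrite -!mulrA ler_wpM2l //.
apply: le_trans (hCL _) _; rewrite ler_wpM2l //.
by rewrite mulrC.
Qed.

End PreconditionedIteration.

(** * Block vectors and the graph Laplacian *)

Section StackedVectors.
Variables (R : realType) (n d : nat).
Implicit Types u v : 'I_n -> 'cV[R]_d.

Lemma stack_submxcol (w : 'cV[R]_(stack_dim n d)) :
  w = stack (fun i => submxcol (p_ := fun _ => d) w i).
Proof. by rewrite /stack submxcolK. Qed.

Lemma dot_stack u v : dot (stack u) (stack v) = \sum_i dot (u i) (v i).
Proof.
by rewrite /dot /stack tr_mxcol mul_mxrow_mxcol summxE.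
Qed.

Lemma stackB u v : stack u - stack v = stack (fun i => u i - v i).
Proof. by rewrite /stack mxcolB. Qed.

Lemma eq_stack u v : (forall i, u i = v i) -> stack u = stack v.
Proof. by move=> uv; apply: eq_mxcol => i *; rewrite uv. Qed.

End StackedVectors.

Section Laplacian.
Variables (R : realType) (n d : nat) (e : rel 'I_n).
Hypothesis he : connected_graph e.
Implicit Types u : 'I_n -> 'cV[R]_d.

Local Notation L := (block_laplacian R d e).

Lemma mul_block_laplacian u :
  L *m stack u = stack (fun i => \sum_(j in neighbors e i) (u i - u j)).
Proof.
case: he => _ irr _.
rewrite /block_laplacian /stack mxblockEv mxcol_mul; apply: eq_mxcol => i *.
rewrite mul_mxrow_mxcol sumrB sumr_const (bigD1 i) //= eqxx mul_scalar_mx scaler_nat.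
congr (_ + _); rewrite -sumrN [RHS]big_mkcond [RHS](bigD1 i) //= inE irr add0r.
apply: eq_bigr => j ji; rewrite eq_sym (negbTE ji).
by case: ifP => _; rewrite ?mul0mx // mulNmx mul1mx.
Qed.

(** Each edge occurs twice in the sum, once for each orientation. *)
Lemma block_laplacian_form u :
  2 * dot (stack u) (L *m stack u) =
  \sum_i \sum_(j in neighbors e i) dot (u i - u j) (u i - u j).
Proof.
case: he => symm _ _.
pose S := \sum_i \sum_(j in neighbors e i) dot (u i) (u i - u j).
have S1 : dot (stack u) (L *m stack u) = S.
  rewrite mul_block_laplacian dot_stack; apply: eq_bigr => i _.
  by rewrite dot_sumr.
have S2 : S = \sum_i \sum_(j in neighbors e i) dot (u j) (u j - u i).
  rewrite /S (exchange_big_dep xpredT) //=; apply: eq_bigr => i _.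
  by apply: eq_bigl => j; rewrite !inE symm.
rewrite S1 mulr_natl mulr2n {2}S2 -big_split; apply: eq_bigr => i _ /=.
rewrite -big_split; apply: eq_bigr => j _ /=.
by rewrite !(dotBl, dotBr); ring.
Qed.

Lemma sym_psd_block_laplacian : sym_psd L.
Proof.
case: (he) => symm _ _; apply/sym_psdP; split.
  rewrite /block_laplacian tr_mxblock; apply: eq_mxblock => i j *.
  rewrite eq_sym !inE symm; case: eqVneq => [->|_]; first by rewrite tr_scalar_mx.
  by case: ifP => _; rewrite ?linearN /= ?trmx1 ?trmx0.
move=> w; rewrite [w]stack_submxcol -(@pmulr_rge0 _ 2) // block_laplacian_form.
by apply: sumr_ge0 => i _; apply: sumr_ge0 => j _; apply: dot_self_ge0.
Qed.

(** The form of L sums the squared differences along the edges, so it vanishes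
    only if u is constant along edges, hence along paths. *)
Lemma block_laplacian_ker u : L *m stack u = 0 -> forall i j, u i = u j.
Proof.
case: (he) => _ _ conn Lu.
have := block_laplacian_form u; rewrite Lu dot0r mulr0 => /esym/eqP.
rewrite psumr_eq0 => [/allP h|i _]; last first.
  by apply: sumr_ge0 => j _; apply: dot_self_ge0.
have edge i j : e i j -> u i = u j.
  move=> eij; have := h i (mem_index_enum _).
  rewrite psumr_eq0 => [/allP/(_ j (mem_index_enum _))|k _]; last exact: dot_self_ge0.
  by rewrite inE eij /= => /eqP/dot_self_eq0/eqP; rewrite subr_eq0 => /eqP.
move=> i j; have /connectP[p] := conn i j.
elim: p i => [i _ ->//|k p IH i] /= /andP[/edge -> pth] jl.
exact: IH.
Qed.

End Laplacian.

(** * Step size and convergence *)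

Section StepSize.
Variables (R : realType) (n : nat).

Lemma le_fam_max (f : 'I_n -> R) i : f i <= fam_max f.
Proof.
apply: ub_le_sup; last by exists i.
exists (\sum_j `|f j|) => _ [j _ <-].
by rewrite (bigD1 j) //= (le_trans (ler_norm _)) // lerDl sumr_ge0.
Qed.

Lemma fam_min_le (f : 'I_n -> R) i : fam_min f <= f i.
Proof.
apply: ge_inf; last by exists i.
exists (- \sum_j `|f j|) => _ [j _ <-].
rewrite lerNl (bigD1 j) //= (le_trans (ler_norm _)) // normrN lerDl.
exact: sumr_ge0.
Qed.

(** The case L = 0 is where the extended quotient is infinite; there the
    hypothesis still forces g > 0, since otherwise the quotient is at most 0. *)
Lemma step_size_bound (a g l : R) : 0 <= l ->
  (0%:E < a%:E < (2 * g)%:E / l%:E)%E -> [/\ 0 < a, 0 < g & a / g * l < 2].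
Proof.
move=> l0 /andP[]; rewrite lte_fin => a0.
have [->|ln0] := eqVneq l 0.
  rewrite inver eqxx => h; have g0 : 0 < g.
    rewrite ltNge; apply/negP => g0; move: h; apply/negP; rewrite -leNgt.
    apply: le_trans (_ : (0 <= _)%E); last by rewrite lee_fin ltW.
    by rewrite mule_le0_ge0 // ?leey // lee_fin; lra.
  by split=> //; rewrite mulr0.
rewrite inver (negbTE ln0) -EFinM lte_fin => h.
have lp : 0 < l by rewrite lt_neqAle eq_sym ln0.
move: h; rewrite ltr_pdivlMr // => h.
have g0 : 0 < g.
  by have := mulr_gt0 a0 lp; lra.
by split=> //; rewrite mulrAC ltr_pdivrMr.
Qed.

End StepSize.

Lemma geometric_cvg_cvg (R : realType) (m : nat) (u : nat -> 'cV[R]_m) z :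
  geometric_cvg u z -> u k @[k --> \oo] --> z.
Proof.
move=> [C [q [C0 q0 q1 h]]]; apply/cvg_ballP => eps eps0.
have : C * q ^+ k @[k --> \oo] --> (0 : R).
  rewrite -[0](mulr0 C); apply: cvgMl_tmp; apply: cvg_expr.
  by rewrite ger0_norm.
move=> /cvgrPdist_lt/(_ _ eps0); apply: filterS => k.
rewrite sub0r normrN => hk; split=> // i j.
rewrite ord1 /ball /=; apply: le_lt_trans hk.
rewrite distrC; apply: le_trans (_ : enorm (u k - z) <= _).
  by have := le_entry_enorm _ _ (u k - z) i; rewrite !mxE.
by apply: le_trans (h k) _; apply: ler_norm.
Qed.

(** From 0 <= |u k - 2 z|^2 one gets |u k|^2 <= 2 |u k - z|^2 + 2 |z|^2, which
    spares the triangle inequality. *)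
Lemma geometric_cvg_bounded (R : realType) (m : nat) (u : nat -> 'cV[R]_m) z :
  geometric_cvg u z -> bounded_seq u.
Proof.
move=> [C [q [C0 q0 q1 h]]].
exists (Num.sqrt (2 * C ^+ 2 + 2 * dot z z)) => k.
rewrite enormE ler_sqrt; last first.
  by rewrite addr_ge0 ?mulr_ge0 ?exprn_ge0 ?dot_self_ge0.
have : dot (u k - z) (u k - z) <= C ^+ 2.
  rewrite -sqr_enorm ler_pXn2r ?nnegrE ?sqrtr_ge0 //.
  by apply: le_trans (h k) _; rewrite ler_piMr // exprn_ile1 // ltW.
have := dot_self_ge0 _ _ (u k - 2 *: z).
rewrite !dotBl !dotBr !dotZl !dotZr [dot z _]dotC.
lra.
Qed.

(** * Convergence to consensus *)

(* The bound on the step size is stated in \bar R, where r / 0 = +oo for r > 0: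
   for n = 1 the Laplacian vanishes and any positive step is allowed. *)
Theorem theorem5 (R : realType) (n d : nat) (hn : (0 < n)%N) (hd : (2 <= d)%N)
  (e : rel 'I_n) (he : connected_graph e)
  (alpha : 'I_n -> R) (halpha : forall i, 0 < alpha i)
  (A : 'I_n -> 'M[R]_d) (hA : forall i, sym_psd (A i)) (hA0 : forall i, A i != 0)
  (x : nat -> 'I_n -> 'cV[R]_d)
  (hx : forall (k : nat) (i : 'I_n),
    x k.+1 i = x k i -
      alpha i *: (\sum_(j in neighbors e i) A i *m (x k i - x k j)))
  (hX : \bigcap_(i in [set: 'I_n]) manifold (x 0%N i) (A i) !=set0)
  (gamma_min alpha_max L_V : R)
  (hgamma : gamma_min = fam_min (fun i => (lambda_max (A i))^-1))
  (halpham : alpha_max = fam_max alpha)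
  (hLV : L_V = opnorm (block_laplacian R d e))
  (hstep : (0%:E < alpha_max%:E < (2 * gamma_min)%:E / L_V%:E)%E) :
  bounded_seq (fun k => stack (x k)) /\
  exists xs : 'cV[R]_d,
    [/\ (\bigcap_(i in [set: 'I_n]) manifold (x 0%N i) (A i)) xs,
        stack (x k) @[k --> \oo] --> consensus n xs
      & geometric_cvg (fun k => stack (x k)) (consensus n xs)].
Proof.
have L0 := opnorm_ge0 _ _ (block_laplacian R d e).
have [a0 g0 small] : [/\ 0 < alpha_max, 0 < gamma_min & alpha_max / gamma_min * L_V < 2].
  by apply: step_size_bound hstep; rewrite hLV.
pose M := \mxdiag_(i < n) (alpha i *: A i).
have MS u : M *m stack u = stack (fun i => alpha i *: (A i *m u i)).
  by rewrite /M /stack mul_mxdiag_mxcol; apply: eq_mxcol => i *; rewrite scalemxAl.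
have formM u : dot (stack u) (M *m stack u) = \sum_i alpha i * dot (u i) (A i *m u i).
  by rewrite MS dot_stack; apply: eq_bigr => i _; rewrite dotZr.
have hM : sym_psd M.
  apply/sym_psdP; split.
    by rewrite /M tr_mxdiag; apply: eq_mxdiag => i; rewrite linearZ /= (hA i).1.
  move=> w; rewrite [w]stack_submxcol formM; apply: sumr_ge0 => i _.
  by rewrite mulr_ge0 ?(ltW (halpha i)) // sym_psd_ge0.
have Mle w : dot w (M *m w) <= alpha_max / gamma_min * dot w w.
  rewrite [w]stack_submxcol formM dot_stack mulr_sumr; apply: ler_sum => i _.
  set v := submxcol _ _.
  have gl : gamma_min <= (lambda_max (A i))^-1 by rewrite hgamma; apply: fam_min_le.
  have lp : 0 < lambda_max (A i) by rewrite -invr_gt0; apply: lt_le_trans gl.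
  have lg : lambda_max (A i) <= gamma_min^-1.
    by rewrite -[leLHS]invrK lef_pV2 ?posrE ?invr_gt0.
  rewrite -mulrA; apply: ler_pM.
  - exact: ltW.
  - exact: sym_psd_ge0.
  - by rewrite halpham; apply: le_fam_max.
  apply: le_trans (form_le_lambda_max _ _ _ (hA i) v) _.
  by rewrite ler_wpM2r ?dot_self_ge0.
case: hX => p Xp.
have {Xp} /choice[v pv] i : exists v, p = x 0%N i + A i *m v.
  by have [v _ <-] := Xp i I; exists v.
pose y k := stack (fun i => x k i - p).
have y0 : y 0%N = M *m stack (fun i => - (alpha i)^-1 *: v i).
  rewrite MS; apply: eq_stack => i; rewrite (pv i) opprD addNKr.
  by rewrite -scalemxAr scalerA mulrN divff ?gt_eqF // scaleN1r.
have yS k : y k.+1 = y k - M *m (block_laplacian R d e *m y k).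
  rewrite mul_block_laplacian // MS stackB; apply: eq_stack => i.
  rewrite hx addrAC; congr (_ - _ *: _); rewrite mulmx_sumr.
  by apply: eq_bigr => j _; rewrite opprB addrA subrK.
have [|||a La cvg] := iteration_geometric_cvg _ _ M _ _ _ hM
  (sym_psd_block_laplacian _ _ _ _ he) _ _ Mle (form_le_opnorm _ _ _) _ _ _ y0 yS.
- by rewrite divr_ge0 // ltW.
- exact: L0.
- by rewrite -hLV.
pose b i := submxcol (p_ := fun _ => d) a i.
pose f i := alpha i *: (A i *m b i).
have ab : a = stack b by exact: stack_submxcol.
rewrite {}ab MS -/f in La cvg.
have fE := block_laplacian_ker _ _ _ _ he _ La.
pose i0 := Ordinal hn.
have gc : geometric_cvg (fun k => stack (x k)) (consensus n (p + f i0)).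
  case: cvg => C [q [C0 q0 q1 h]]; exists C, q; split=> // k.
  have := h k; rewrite /y /consensus !stackB.
  congr (enorm _ <= _); apply: eq_stack => i.
  by rewrite (fE i0 i) opprD addrA.
split; first exact: geometric_cvg_bounded gc.
exists (p + f i0); split=> //; last exact: geometric_cvg_cvg.
move=> i _; rewrite (fE i0 i) {1}(pv i).
exists (v i + alpha i *: b i) => //.
by rewrite mulmxDr -scalemxAr addrA.
Qed.
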